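(* Let $\alpha\in(0,1)$ and $\varepsilon\in(0,1)$. Suppose $|H(\mathbf{f})-H(\widetilde{\mathbf{f}})|\le\alpha H(\widetilde{\mathbf{f}})$ and $F_1(\mathbf{f})\ge(1-\alpha)F_1(\widetilde{\mathbf{f}})$. There is a one-pass streaming algorithm that, with high constant probability, estimates $H(\mathbf{f})$ to within additive error $\varepsilon$ in the forget model, using $\widetilde{O}\!\left(\frac{1}{\varepsilon^2(1-t\alpha)}\,\mathrm{poly}\log n\right)$ bits of space, where $t=1+O(1/\log n)$.
   Context: Forget model: universe $[n]$, stream of length $\mathrm{poly}(n)$ consisting of insertions $(i,+)$ (increment coordinate $i$) and forget requests on $i$ (set coordinate $i$ of the current vector to $0$). $\mathbf{f}$ is the actual final frequency vector; $\widetilde{\mathbf{f}}$ is the final vector when all forget requests are removed. $F_1(\mathbf{v})=\|\mathbf{v}\|_1$ and the entropy is $H(\mathbf{v})=-\sum_i p_i\log p_i$ with $p_i=|v_i|/\|\mathbf{v}\|_1$. $\widetilde{O}$ hides polylogarithmic factors. *)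

(* Defs.v *)
From HB Require Import structures.
From mathcomp Require Import all_boot all_order all_algebra.
From mathcomp Require Import all_classical all_reals all_analysis.
Set Implicit Arguments. Unset Strict Implicit. Unset Printing Implicit Defensive.
Import Order.TTheory GRing.Theory Num.Theory.
Local Open Scope ring_scope.

Inductive op (n : nat) : Type :=
| Ins of 'I_n
| Forget of 'I_n.

Definition apply_op (n : nat) (v : 'I_n -> nat) (o : op n) : 'I_n -> nat :=
  match o with
  | Ins i => fun j => if j == i then (v j).+1 else v j
  | Forget i => fun j => if j == i then 0%N else v j
  end.

Definition apply_op_noforget (n : nat) (v : 'I_n -> nat) (o : op n) : 'I_n -> nat :=
  match o with
  | Ins i => fun j => if j == i then (v j).+1 else v j
  | Forget _ => v
  end.

Definition freq (n : nat) (s : seq (op n)) : 'I_n -> nat :=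
  foldl (@apply_op n) (fun _ => 0%N) s.

Definition freq_noforget (n : nat) (s : seq (op n)) : 'I_n -> nat :=
  foldl (@apply_op_noforget n) (fun _ => 0%N) s.

Definition F1 (n : nat) (v : 'I_n -> nat) : nat := (\sum_(i < n) v i)%N.

Definition log2 {R : realType} (x : R) : R := ln x / ln 2.

Definition entropy {R : realType} (n : nat) (v : 'I_n -> nat) : R :=
  - \sum_(i < n)
      (let p : R := (v i)%:R / (F1 v)%:R in
       if p == 0 then 0 else p * log2 p).

(* A one-pass randomized streaming algorithm with memory state a bitstring.
   At every step it receives the next stream item and a fresh uniformly random
   coin from a finite set of size coinK.+1 (private randomness is NOT stored
   for free: anything to be remembered must be kept in the state). *)
Record streaming_alg (R : realType) (n : nat) := StreamingAlg {
  coinK : nat;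
  init : seq bool;
  step : seq bool -> op n -> 'I_coinK.+1 -> seq bool;
  out : seq bool -> R
}.

Fixpoint run_states (R : realType) (n : nat) (A : streaming_alg R n)
    (st : seq bool) (s : seq (op n)) (w : seq 'I_(coinK A).+1) : seq (seq bool) :=
  match s, w with
  | o :: s', c :: w' => st :: @run_states R n A (@step R n A st o c) s' w'
  | _, _ => [:: st]
  end.

Fixpoint final_state (R : realType) (n : nat) (A : streaming_alg R n)
    (st : seq bool) (s : seq (op n)) (w : seq 'I_(coinK A).+1) : seq bool :=
  match s, w with
  | o :: s', c :: w' => @final_state R n A (@step R n A st o c) s' w'
  | _, _ => st
  end.

Definition space_le (R : realType) (n : nat) (A : streaming_alg R n)
    (S : R) (s : seq (op n)) : Prop :=
  forall w : (size s).-tuple 'I_(coinK A).+1,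
    forall st, st \in @run_states R n A (init A) s w -> (size st)%:R <= S.

Definition success_prob (R : realType) (n : nat) (A : streaming_alg R n)
    (s : seq (op n)) (good : R -> bool) : R :=
  (#|[pred w : (size s).-tuple 'I_(coinK A).+1 |
        good (out A (@final_state R n A (init A) s w))]|)%:R
  / (((coinK A).+1 ^ size s)%N)%:R.

(* Main.v *)
(* Reservoir sampling keeps uniform insertions of the stream, each with the count [r] of the
   occurrences of its item from there on; a forget request on the item kills the sample. With [m]
   surviving insertions out of [M], a sample is alive with probability [m / M], and given that it is
   alive, [r ln r - (r - 1) ln (r - 1)] has mean [(\sum_i f_i ln f_i) / m] and is bounded by
   [ln T + 1] on streams of length at most [T]. As [H(f) ln 2 = ln m - (\sum_i f_i ln f_i) / m],
   Chebyshev's inequality for the fraction of live samples and for the mean of this statistic gives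
   the additive error with polylog / (eps (1 - alpha))^2 samples. *)

Require Import Defs.
From HB Require Import structures.
From mathcomp Require Import all_boot all_order all_algebra.
From mathcomp Require Import all_classical all_reals all_analysis.
From mathcomp Require Import ring lra.
Set Implicit Arguments. Unset Strict Implicit. Unset Printing Implicit Defensive.
Import Order.TTheory GRing.Theory Num.Theory.
Local Open Scope ring_scope.

(** * Second moments over tuples and Markov's inequality by counting *)

Lemma big_tuple_cons (R : nmodType) (T : finType) k (F : k.+1.-tuple T -> R) :
  \sum_(w : k.+1.-tuple T) F w = \sum_(x : T) \sum_(w : k.-tuple T) F [tuple of x :: w].
Proof.
rewrite pair_big /= (reindex (fun p : T * k.-tuple T => [tuple of p.1 :: p.2])) //=.
exists (fun w => (thead w, [tuple of behead w])) => [[x w] _|w _] /=.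
  by congr pair; apply/val_inj.
by rewrite -tuple_eta.
Qed.

(** The variance of a sum of independent centred variables is additive; multiplying by [#|T|]
    replaces expectations by division-free sums. *)
Lemma sum_tuple_sqr (R : comPzRingType) (T : finType) k (X : T -> R) :
  \sum_(x : T) X x = 0 ->
  \sum_(w : k.-tuple T) (\sum_(i < k) X (tnth w i)) ^+ 2 * #|T|%:R
  = (k * #|T| ^ k)%N%:R * \sum_(x : T) X x ^+ 2.
Proof.
move=> X0; elim: k => [|k IH].
  rewrite mul0n mul0r big1 // => w _.
  by rewrite big_ord0 expr0n mul0r.
rewrite big_tuple_cons.
(* Split off the first coordinate and expand the square; the cross term vanishes on summing over [x]
   by [X0]. *)
transitivity (\sum_(x : T) \sum_(w : k.-tuple T)
    (X x ^+ 2 * #|T|%:R + X x * (2 * #|T|%:R * \sum_(i < k) X (tnth w i))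
     + (\sum_(i < k) X (tnth w i)) ^+ 2 * #|T|%:R)).
  apply: eq_bigr => x _; apply: eq_bigr => w _.
  rewrite big_ord_recl tnth0.
  under [X in _ + X]eq_bigr do rewrite tnthS.
  ring.
under eq_bigr => x _ do rewrite !big_split /= IH sumr_const card_tuple -mulr_sumr.
rewrite !big_split /= -mulr_suml X0 mul0r addr0 sumr_const sumrMnl -mulr_suml.
rewrite -[_ *+ (#|T| ^ k)]mulr_natr -[_ *+ #|_|]mulr_natr expnS !natrM -[k.+1%:R]natr1.
ring.
Qed.

(** Markov's inequality at three times the bound on the mean, which is where the success probability
    2/3 originates. *)
Lemma card_markov (R : realFieldType) (U : finType) (Z : U -> R) (a : R) :
  0 < a -> (forall u, 0 <= Z u) -> \sum_u Z u <= a * #|U|%:R ->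
  2 / 3 * (#|U|%:R : R) <= #|[pred u | Z u <= 3 * a]|%:R.
Proof.
move=> a0 Z0 hZ.
set P := [pred u | _].
have h : 3 * a * #|predC P|%:R <= a * #|U|%:R.
  apply: le_trans hZ.
  rewrite [leRHS](bigID P) /= -[leLHS]add0r; apply: lerD; first exact: sumr_ge0.
  rewrite mulr_natr -sumr_const; apply: ler_sum => u.
  by rewrite inE /= -ltNge => /ltW.
have := cardC P => /(congr1 (fun k : nat => k%:R : R)); rewrite natrD => <-.
move: h; rewrite -mulrA mulrCA ler_pM2l //.
have := cardC P => /(congr1 (fun k : nat => k%:R : R)); rewrite natrD => <-.
lra.
Qed.

Lemma sum_ord_ltn (R : pzRingType) (D e : nat) (a b : R) : (e <= D)%N ->
  \sum_(x < D) (if (x < e)%N then a else b) = a *+ e + b *+ (D - e).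
Proof.
move=> le; rewrite -(big_mkord xpredT (fun x => if (x < e)%N then a else b)).
rewrite (big_cat_nat (leq0n e) le) /=; congr (_ + _).
  rewrite (eq_big_nat _ _ (F2 := fun=> a)); last by move=> i /andP[_ ->].
  by rewrite sumr_const_nat subn0.
rewrite (eq_big_nat _ _ (F2 := fun=> b)); last by move=> i /andP[h _]; rewrite ltnNge h.
by rewrite sumr_const_nat.
Qed.

(** * Reservoir sampling *)

(* A sampled insertion of [i] is remembered as [Some (i, r)], where [r] counts it and the later
   insertions of [i]; it becomes [None] once [i] is forgotten. *)
Definition sample (n : nat) := option ('I_n * nat).

Definition is_ins n (o : op n) : bool := if o is Ins _ then true else false.

Definition num_ins n (s : seq (op n)) : nat := count (@is_ins n) s.

Definition age n (x : sample n) (o : op n) : sample n :=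
  match x, o with
  | Some (i, r), Ins j => Some (i, if j == i then r.+1 else r)
  | Some (i, r), Forget j => if j == i then None else x
  | None, _ => None
  end.

(* With [c] uniform below [D] and [t.+1 %| D], the new insertion is kept with probability
   exactly [1 / t.+1]. *)
Definition resample n D (t : nat) (x : sample n) (o : op n) (c : 'I_D) : sample n :=
  match o with
  | Ins i => if (c < D %/ t.+1)%N then Some (i, 1%N) else age x o
  | Forget _ => age x o
  end.

Fixpoint reservoir n D (t : nat) (x : sample n) (s : seq (op n)) (w : seq 'I_D) : sample n :=
  match s, w with
  | o :: s', c :: w' => reservoir (t + is_ins o) (resample t x o c) s' w'
  | _, _ => x
  end.

Fixpoint sum_ins (R : nmodType) n (g : sample n -> R) (s : seq (op n)) : R :=
  match s with
  | [::] => 0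
  | o :: s' => (if o is Ins i then g (foldl (@age n) (Some (i, 1%N)) s') else 0) + sum_ins g s'
  end.

(** Invariant behind the uniformity of reservoir sampling: the current sample stands for the [t]
    insertions already seen and each insertion to come has weight 1. Both [t] and [x] vary in the
    induction. *)
Lemma sum_reservoir (R : comPzRingType) n D (g : sample n -> R) s t x :
  (forall d, (0 < d <= t + num_ins s)%N -> (d %| D)%N) ->
  \sum_(w : (size s).-tuple 'I_D) g (reservoir t x s w) * (t + num_ins s)%:R
  = (t%:R * g (foldl (@age n) x s) + sum_ins g s) * (D ^ size s)%:R.
Proof.
elim: s t x => [|o s IH] t x hD /=.
  rewrite addn0 addr0 expn0 mulr1 -mulr_suml mulrC; congr (_ * _).
  by rewrite sumr_const card_tuple expn0 mulr1n.
rewrite big_tuple_cons /=.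
have e : (t + (is_ins o + num_ins s) = t + is_ins o + num_ins s)%N by rewrite addnA.
rewrite e; rewrite /= e in hD.
under eq_bigr => c _ do rewrite IH //.
rewrite -mulr_suml big_split /= sumr_const card_ord -mulr_sumr.
case: o hD {e} => i /= hD; last first.
  rewrite sumr_const card_ord !addn0 expnS natrM -[_ *+ D]mulr_natr; ring.
rewrite addn1 in hD *.
(* Divisibility makes the odds exact: [q] coins install the new insertion and [q * t] keep the old
   sample. *)
have /dvdnP[q Dq] : (t.+1 %| D)%N by apply: hD; rewrite ltnS leq0n leq_addr.
have -> : \sum_(c < D) g (foldl (age (n:=n)) (if (c < D %/ t.+1)%N then Some (i, 1%N)
     else age x (Ins i)) s)
  = \sum_(c < D) if (c < D %/ t.+1)%N then g (foldl (age (n:=n)) (Some (i, 1%N)) s) else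
       g (foldl (age (n:=n)) (age x (Ins i)) s).
  by apply: eq_bigr => c _; case: ifP.
rewrite sum_ord_ltn ?leq_div //.
have -> : (D %/ t.+1 = q)%N by rewrite Dq mulnK.
have -> : (D - q = q * t)%N by rewrite Dq mulnS addnC addnK.
set a := g _; set b := g _.
rewrite -[a *+ q]mulr_natr -[b *+ _]mulr_natr -[_ *+ D]mulr_natr expnS Dq !natrM -[t.+1%:R]natr1.
ring.
Qed.

Definition live (R : pzRingType) n (f : nat -> R) (x : sample n) : R :=
  if x is Some (_, r) then f r else 0.

Lemma age_foldl_None n (s : seq (op n)) : foldl (@age n) None s = None.
Proof. by elim: s. Qed.

Definition unforgotten n (i : 'I_n) (s : seq (op n)) : bool :=
  all (fun o => if o is Forget j then j != i else true) s.

(** [freq] is a left fold, so induction on the first operation requires an arbitrary initial vector,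
    whose entry at [i] matters only if [i] is never forgotten. *)
Lemma foldl_apply_op n (s : seq (op n)) v i :
  foldl (@apply_op n) v s i = ((if unforgotten i s then v i else 0) + freq s i)%N.
Proof.
rewrite /freq; elim: s v => [|o s IH] v /=; first by rewrite addn0.
rewrite IH [in RHS]IH addnA; congr addn.
case: o => j /=; rewrite [i == j]eq_sym; case: eqVneq => //= _; case: unforgotten => //=.
all: by rewrite ?addn1 ?addn0.
Qed.

Lemma foldl_age n (s : seq (op n)) i r :
  foldl (@age n) (Some (i, r)) s =
  if unforgotten i s then Some (i, (r + freq s i)%N) else None.
Proof.
elim: s r => [|o s IH] r /=; first by rewrite addn0.
rewrite /freq /= foldl_apply_op.
case: o => j /=; rewrite [i == j]eq_sym; case: eqVneq => [_|_] /=.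
- by rewrite IH; case: unforgotten => //; rewrite addnA addn1.
- by rewrite IH; case: unforgotten.
- by rewrite age_foldl_None.
- by rewrite IH; case: unforgotten.
Qed.

(** Counted from the end of the stream, the surviving insertions of [i] carry the counts 1, ...,
    [freq s i], once each; a forgotten insertion contributes 0. *)
Lemma sum_ins_live (R : pzRingType) n (f : nat -> R) (s : seq (op n)) :
  sum_ins (live f) s = \sum_(i < n) \sum_(r < freq s i) f r.+1.
Proof.
elim: s => [|o s IH]; first by rewrite big1 // => i _; rewrite /freq big_ord0.
rewrite /= {}IH /freq /=.
case: o => i; last first.
  rewrite add0r; apply: eq_bigr => j _; rewrite [in RHS]foldl_apply_op /=.
  by rewrite !if_same.
rewrite (bigD1 i) //= [in RHS](bigD1 i) //= addrA; congr (_ + _).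
  rewrite foldl_age [in RHS]foldl_apply_op /= eqxx.
  case: unforgotten; last by rewrite add0r.
  by rewrite add1n big_ord_recr /= addrC.
apply: eq_bigr => j /negPf ji; rewrite [in RHS]foldl_apply_op /= ji.
by case: unforgotten.
Qed.

Lemma freq_le_noforget n (s : seq (op n)) i : (freq s i <= freq_noforget s i)%N.
Proof.
rewrite /freq /freq_noforget.
have : forall v v' : 'I_n -> nat, (forall i, v i <= v' i)%N ->
   (foldl (@apply_op n) v s i <= foldl (@apply_op_noforget n) v' s i)%N.
  elim: s => [|o s IH] v v' h //=; apply: IH => j.
  by move: (h j); case: o => k /=; case: ifP.
exact.
Qed.

Lemma F1_noforget n (s : seq (op n)) : F1 (freq_noforget s) = num_ins s.
Proof.
have h v : F1 (foldl (@apply_op_noforget n) v s) = (F1 v + num_ins s)%N.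
  elim: s v => [|o s IH] v /=; first by rewrite addn0.
  rewrite IH addnA; congr addn; case: o => i /=; last by rewrite addn0.
  rewrite /F1 (bigD1 i) //= eqxx [in RHS](bigD1 i) //= addn1 addSn; congr (_ + _).+1.
  by apply: eq_bigr => j /negPf ->.
by rewrite /freq_noforget h /F1 big1.
Qed.

Lemma F1_freq_le n (s : seq (op n)) : (F1 (freq s) <= num_ins s)%N.
Proof. by rewrite -F1_noforget; apply: leq_sum => i _; exact: freq_le_noforget. Qed.

Lemma freq_le_size n (s : seq (op n)) i : (freq s i <= size s)%N.
Proof.
apply: leq_trans (count_size (@is_ins n) s).
by apply: leq_trans (F1_freq_le s); rewrite /F1 (bigD1 i) //= leq_addr.
Qed.

(** * Algorithms with a finite set of memory states *)

Lemma finite_bits (F : finType) (x0 : F) b : (#|F| <= 2 ^ b)%N ->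
  exists (enc : F -> seq bool) (dec : seq bool -> F),
    cancel enc dec /\ forall x, size (enc x) = b.
Proof.
move=> le; have le' : (#|F| <= #|{: b.-tuple bool}|)%N by rewrite card_tuple card_bool.
pose enc (x : F) : b.-tuple bool := enum_val (widen_ord le' (enum_rank x)).
exists (fun x => tval (enc x)), (fun bits => odflt x0 [pick x | tval (enc x) == bits]).
split=> [x|x]; last exact: size_tuple.
case: pickP => [y /= /eqP/val_inj/enum_val_inj /(congr1 val) /= h|/(_ x)]; last by rewrite eqxx.
by apply/enum_rank_inj/val_inj.
Qed.

Fixpoint run n (S C : Type) (step : S -> op n -> C -> S) (x : S) (s : seq (op n)) (w : seq C) : S :=
  match s, w with
  | o :: s', c :: w' => run step (step x o c) s' w'
  | _, _ => x
  end.

(** States are stored as codes of fixed length [b], and coins from any inhabited finite type are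
    relabelled bijectively by ordinals, which preserves the uniform distribution. *)
Lemma finite_streaming_alg (R : realType) n (F C : finType) (x0 : F) (c0 : C)
    (stp : F -> op n -> C -> F) (est : F -> R) b : (#|F| <= 2 ^ b)%N ->
  exists A : streaming_alg R n,
    (forall s, space_le A b%:R s) /\
    forall s good, success_prob A s good =
      #|[pred w : (size s).-tuple C | good (est (run stp x0 s w))]|%:R / (#|C| ^ size s)%N%:R.
Proof.
move=> le; have [enc [dec [encK size_enc]]] := finite_bits x0 le.
have C0 : (0 < #|C|)%N by apply/card_gt0P; exists c0.
have eC := prednK C0.
pose coin (c : 'I_#|C|.-1.+1) : C := enum_val (cast_ord eC c).
have coin_bij : bijective coin.
  exists (fun x => cast_ord (esym eC) (enum_rank x)) => c.
    by rewrite /coin enum_valK cast_ordK.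
  by rewrite /coin cast_ordKV enum_rankK.
pose A := @StreamingAlg R n #|C|.-1 (enc x0)
  (fun st o c => enc (stp (dec st) o (coin c))) (est \o dec).
exists A; split.
  rewrite /space_le /=.
  have H s (w : seq 'I_(coinK A).+1) x st :
      st \in run_states (A := A) (enc x) s w -> size st = b.
    elim: s w x => [|o s IH] [|c w] x /=; rewrite inE; try by move=> /eqP ->.
    by case/orP => [/eqP ->|/IH].
  by move=> s w st /H ->.
have final s (w : seq 'I_(coinK A).+1) x :
    final_state (A := A) (enc x) s w = enc (run stp x s (map coin w)).
  by elim: s w x => [|o s IH] [|c w] x //=; rewrite encK IH.
move=> s good; rewrite /success_prob /=; congr (_%:R / (_ ^ _)%:R); last by rewrite eC.
rewrite -[LHS]sum1_card -[RHS]sum1_card [RHS](reindex (fun w : (size s).-tuple _ => map_tuple coin w)) /=.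
  by apply: eq_bigl => w; rewrite !inE final encK.
apply: onW_bij; case: coin_bij => g fg gf.
by exists (map_tuple g) => w; apply/val_inj; rewrite /= mapK.
Qed.

(** * Parallel reservoirs in bounded memory *)

Section ReservoirAlg.
Variables (n T D N : nat).

Let F := ('I_T.+1 * N.-tuple (option ('I_n * 'I_T.+1)))%type.

Definition trunc_sample (x : sample n) : option ('I_n * 'I_T.+1) :=
  omap (fun p => (p.1, inord p.2)) x.

Definition untrunc_sample (x : option ('I_n * 'I_T.+1)) : sample n :=
  omap (fun p => (p.1, val p.2)) x.

(** Invariant that makes truncation lossless: after [t] insertions no count exceeds [t]. *)
Definition bounded_sample (t : nat) (x : sample n) : bool :=
  if x is Some (_, r) then (r <= t)%N else true.

Lemma trunc_sampleK t x : (t <= T)%N -> bounded_sample t x ->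
  untrunc_sample (trunc_sample x) = x.
Proof.
move=> tT; case: x => [[i r]|] //= rt.
by rewrite inordK // ltnS (leq_trans rt).
Qed.

Lemma bounded_resample t x o (c : 'I_D) : bounded_sample t x ->
  bounded_sample (t + is_ins o) (resample t x o c).
Proof.
case: o => i /=; rewrite ?addn0 ?addn1; last first.
  by case: x => [[j r]|] //=; case: ifP.
case: ifP => // _; case: x => [[j r]|] //=; case: ifP => // _ /leqW //.
Qed.

Definition reservoir_step (f : F) (o : op n) (c : N.-tuple 'I_D) : F :=
  (inord (f.1 + is_ins o),
   [tuple trunc_sample (resample f.1 (untrunc_sample (tnth f.2 j)) o (tnth c j)) | j < N]).

Lemma run_reservoir_step s (w : seq (N.-tuple 'I_D)) t (xs : N.-tuple (sample n)) :
  size w = size s -> (t + size s <= T)%N -> all (bounded_sample t) xs ->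
  run reservoir_step (inord t, map_tuple trunc_sample xs) s w =
  (inord (t + num_ins s),
   [tuple trunc_sample (reservoir t (tnth xs j) s [seq tnth c j | c : N.-tuple 'I_D <- w]) | j < N]).
Proof.
elim: s w t xs => [|o s IH] [|c w] t xs //=.
  move=> _ _ _; rewrite addn0; congr pair.
  by apply: eq_from_tnth => j; rewrite tnth_map tnth_mktuple.
move=> [sw] ht hxs.
have tT : (t <= T)%N by rewrite (leq_trans _ ht) // leq_addr.
pose ys := [tuple resample t (tnth xs j) o (tnth c j) | j < N].
have -> : reservoir_step (inord t, map_tuple trunc_sample xs) o c =
   (inord (t + is_ins o), map_tuple trunc_sample ys).
  rewrite /reservoir_step /= inordK ?ltnS //; congr pair.
  apply: eq_from_tnth => j; rewrite tnth_mktuple [RHS]tnth_map tnth_mktuple tnth_map.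
  by rewrite (trunc_sampleK tT) // (allP hxs) // mem_tnth.
rewrite IH //.
- rewrite addnA; congr pair; apply: eq_from_tnth => j.
  by rewrite !tnth_mktuple.
- by rewrite -addnA (leq_trans _ ht) // leq_add2l; case: (o).
- apply/allP => y /tnthP[j ->]; rewrite tnth_mktuple; apply: bounded_resample.
  by rewrite (allP hxs) // mem_tnth.
Qed.

Lemma bounded_reservoir s (w : seq 'I_D) t x : (t + size s <= T)%N ->
  bounded_sample t x -> bounded_sample T (reservoir t x s w).
Proof.
elim: s w t x => [|o s IH] [|c w] t x /= ht hx;
  try by case: x hx => [[i r]|] //= /leq_trans -> //; rewrite (leq_trans _ ht) // leq_addr.
apply: IH; last exact: bounded_resample.
by rewrite -addnA (leq_trans _ ht) // leq_add2l; case: (o).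
Qed.

(** Each step draws one coin per reservoir, so regrouping the coins by reservoir gives [N]
    independent runs on the same stream. *)
Lemma reservoir_alg (R : realType) (est : nat -> seq (sample n) -> R) b :
  (0 < D)%N -> (T.+1 * (n * T.+1).+1 ^ N <= 2 ^ b)%N ->
  exists A : streaming_alg R n,
    (forall s, space_le A b%:R s) /\
    forall s good, (size s <= T)%N -> success_prob A s good =
      #|[pred W : N.-tuple ((size s).-tuple 'I_D) |
         good (est (num_ins s) [seq reservoir 0 None s v | v : (size s).-tuple 'I_D <- W])]|%:R
      / #|{: N.-tuple ((size s).-tuple 'I_D)}|%:R.
Proof.
move=> D0 hb.
have cF : (#|{: F}| <= 2 ^ b)%N.
  by rewrite card_prod card_tuple card_option card_prod !card_ord.
pose none := [tuple (None : sample n) | _ < N].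
have [A [spA prA]] := @finite_streaming_alg R n F _ (inord 0, map_tuple trunc_sample none)
  (nseq_tuple N (Ordinal D0)) reservoir_step
  (fun f => est f.1 [seq untrunc_sample x | x <- f.2]) b cF.
exists A; split=> // s good hs; rewrite prA card_tuple card_tuple card_tuple.
rewrite -!expnM mulnC card_ord mulnC; congr (_%:R / _).
(* Transposition of the coin matrix; injectivity and equal cardinalities make it a bijection. *)
pose tr (w : (size s).-tuple (N.-tuple 'I_D)) : N.-tuple ((size s).-tuple 'I_D) :=
  [tuple map_tuple (fun c : N.-tuple 'I_D => tnth c j) w | j < N].
have tr_inj : injective tr.
  move=> w w' eq; apply: eq_from_tnth => i; apply: eq_from_tnth => j.
  by have := congr1 (fun W => tnth (tnth W j) i) eq; rewrite /= !tnth_mktuple !tnth_map.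
have tr_bij : bijective tr.
  by apply: inj_card_bij => //; rewrite !card_tuple -!expnM mulnC.
rewrite -[LHS]sum1_card -[RHS]sum1_card [RHS](reindex tr) /=; last exact: onW_bij.
apply: eq_bigl => w; rewrite !inE; congr (good _).
rewrite run_reservoir_step ?size_tuple //; last first.
  by apply/allP => y /tnthP[j ->]; rewrite tnth_mktuple.
rewrite /= add0n inordK; last first.
  by rewrite ltnS (leq_trans _ hs) // count_size.
congr est; rewrite -!map_comp; apply: eq_map => j /=.
rewrite tnth_mktuple (trunc_sampleK (leqnn T)) //.
exact: bounded_reservoir.
Qed.

End ReservoirAlg.

(** * The estimator *)

Definition xlnx (R : realType) (r : nat) : R := r%:R * ln r%:R.

(* [xlnx_diff R r] summed over [0 <= r < v] telescopes to [v ln v], so its value at the index of a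
   uniform surviving insertion has mean [\sum_i v_i ln v_i / F1 v]. *)
Definition xlnx_diff (R : realType) (r : nat) : R := xlnx R r - xlnx R r.-1.

Lemma sum_xlnx_diff (R : realType) v : \sum_(r < v) xlnx_diff R r.+1 = xlnx R v.
Proof.
rewrite -(big_mkord xpredT (fun r => xlnx R r.+1 - xlnx R r)) telescope_sumr //.
by rewrite /xlnx mul0r subr0.
Qed.

(** For r > 0, (r + 1) ln (r + 1) - r ln r = ln (r + 1) + r ln (1 + 1/r), and the last term lies
    between 0 and 1 because ln (1 + x) <= x. *)
Lemma xlnx_diff_bounds (R : realType) r T : (r < T)%N ->
  0 <= xlnx_diff R r.+1 <= ln T%:R + 1.
Proof.
move=> rT; rewrite /xlnx_diff /xlnx /=.
have lnT : ln r.+1%:R <= ln T%:R :> R.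
  by rewrite ler_ln ?posrE ?ltr0n ?ler_nat //; apply: leq_trans rT.
case: r rT lnT => [|r] rT lnT.
  by rewrite ln1 mulr0 mul0r subr0 lexx -[0]addr0 lerD // ln_ge0 // ler1n.
have r0 : 0 < r.+1%:R :> R by rewrite ltr0n.
have ln0 : 0 <= ln r.+2%:R :> R by rewrite ln_ge0 // ler1n.
have e : ln r.+2%:R - ln r.+1%:R = ln (1 + r.+1%:R^-1) :> R.
  by rewrite -ln_div ?posrE ?ltr0n // -natr1 mulrDl divff ?gt_eqF // mul1r.
have lo : 0 <= ln (1 + r.+1%:R^-1) :> R by rewrite ln_ge0 // lerDl invr_ge0 ltW.
have hi : r.+1%:R * ln (1 + r.+1%:R^-1) <= 1 :> R.
  rewrite -ler_pdivlMl // mulr1 le_ln1Dx // (lt_le_trans (ltrN10 _)) // invr_ge0 ltW //.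
have lo' : 0 <= r.+1%:R * ln (1 + r.+1%:R^-1) :> R by rewrite mulr_ge0 // ltW.
have -> : r.+2%:R * ln r.+2%:R - r.+1%:R * ln r.+1%:R
   = ln r.+2%:R + r.+1%:R * ln (1 + r.+1%:R^-1) :> R.
  by rewrite -e; move: (ln _) (ln _) => a b; rewrite -[r.+2%:R]natr1; ring.
by apply/andP; split; [exact: addr_ge0|exact: lerD].
Qed.

Lemma entropyE (R : realType) n (v : 'I_n -> nat) :
  entropy v = (ln (F1 v)%:R - (\sum_(i < n) xlnx R (v i)) / (F1 v)%:R) / ln 2 :> R.
Proof.
rewrite /entropy.
(* For the zero vector both sides are 0, by the conventions on [ln 0] and division by 0. *)
have [m0|m0] := posnP (F1 v).
  rewrite m0 big1 ?oppr0; last by move=> i _; rewrite invr0 mulr0 eqxx.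
  by rewrite ln0 // invr0 mulr0 subr0 mul0r.
have m0' : 0 < (F1 v)%:R :> R by rewrite ltr0n.
have sum1 : \sum_(i < n) (v i)%:R / (F1 v)%:R = 1 :> R.
  by rewrite -mulr_suml -natr_sum divff // gt_eqF.
have -> : ln (F1 v)%:R = ln (F1 v)%:R * \sum_(i < n) (v i)%:R / (F1 v)%:R :> R.
  by rewrite sum1 mulr1.
rewrite mulr_sumr mulr_suml -sumrB mulr_suml -sumrN; apply: eq_bigr => i _.
have [vi0|vi0] := posnP (v i).
  by rewrite vi0 /xlnx !mul0r eqxx !mulr0 subrr mul0r oppr0.
have vi0' : 0 < (v i)%:R :> R by rewrite ltr0n.
rewrite gt_eqF ?divr_gt0 // /log2 ln_div ?posrE // /xlnx.
ring.
Qed.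

Lemma sum_live_reservoir (R : realType) n T (s : seq (op n)) (f : nat -> R) :
  (size s <= T)%N -> (0 < num_ins s)%N ->
  \sum_(w : (size s).-tuple 'I_T`!) live f (reservoir 0 None s w) =
  (\sum_(i < n) \sum_(r < freq s i) f r.+1) / (num_ins s)%:R
    * #|{: (size s).-tuple 'I_T`!}|%:R.
Proof.
move=> sT M0; have M0' : (num_ins s)%:R != 0 :> R by rewrite pnatr_eq0 -lt0n.
have := @sum_reservoir R n T`! (live f) s 0%N None.
rewrite add0n mul0r add0r sum_ins_live -mulr_suml card_tuple card_ord => eq.
rewrite mulrAC -eq ?mulfK // => d /andP[d0 dM]; rewrite dvdn_fact // d0 (leq_trans dM) //.
by apply: leq_trans sT; exact: count_size.
Qed.

(** * Concentration of sample means and propagation of errors *)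

Lemma sum_mean_sqr (R : realType) (W : finType) (N : nat) (g : W -> R) (mu B : R) :
  (0 < N)%N -> \sum_x g x = mu * #|W|%:R -> \sum_x g x ^+ 2 <= B * #|W|%:R ->
  \sum_(w : N.-tuple W) ((\sum_(x <- w) g x) / N%:R - mu) ^+ 2
    <= B / N%:R * #|{: N.-tuple W}|%:R.
Proof.
move=> N0 hg hB; have N0' : 0 < N%:R :> R by rewrite ltr0n.
have X0 : \sum_x (g x - mu) = 0.
  by rewrite sumrB hg sumr_const mulr_natr subrr.
have hX : \sum_x (g x - mu) ^+ 2 <= B * #|W|%:R.
  apply: le_trans hB.
  (* The variance is the second moment minus the squared mean, hence at most [B]. *)
  have -> : \sum_x (g x - mu) ^+ 2 = \sum_x g x ^+ 2 - mu ^+ 2 * #|W|%:R.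
    rewrite (eq_bigr (fun x => g x ^+ 2 + (- (2 * mu) * (g x - mu) - mu ^+ 2))); last first.
      by move=> x _; ring.
    by rewrite big_split sumrB /= -mulr_sumr X0 mulr0 sub0r sumr_const mulr_natr.
  by rewrite lerBlDr lerDl mulr_ge0 // sqr_ge0.
have [/eqP W0|W0] := posnP #|W|.
  rewrite card_tuple (eqP W0) exp0n // mulr0 big1 //.
  by move=> w; have := card0_eq (eqP W0) (tnth w (Ordinal N0)).
have W0' : 0 < #|W|%:R :> R by rewrite ltr0n.
have := sum_tuple_sqr N X0; rewrite -mulr_suml => eq.
have le : \sum_(w : N.-tuple W) (\sum_(i < N) (g (tnth w i) - mu)) ^+ 2
    <= N%:R * (#|W| ^ N)%:R * B.
  by rewrite -(ler_pM2r W0') eq -natrM -[leRHS]mulrA ler_wpM2l ?ler0n.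
have -> : \sum_(w : N.-tuple W) ((\sum_(x <- w) g x) / N%:R - mu) ^+ 2
    = \sum_(w : N.-tuple W) (\sum_(i < N) (g (tnth w i) - mu)) ^+ 2 / N%:R ^+ 2.
  apply: eq_bigr => w _; rewrite big_tuple sumrB sumr_const card_ord.
  by rewrite -exprVn -exprMn mulrBl -[mu *+ N]mulr_natr mulfK // gt_eqF.
rewrite -mulr_suml card_tuple ler_pdivrMr ?exprn_gt0 //.
by apply: le_trans le _; rewrite le_eqVlt; apply/orP; left; apply/eqP; field; rewrite gt_eqF.
Qed.

Lemma ln2_ge_half (R : realType) : 1 / 2 <= ln 2 :> R.
Proof.
have : ln (1 + - (1 / 2)) <= - (1 / 2) :> R by apply: le_ln1Dx; lra.
have -> : 1 + - (1 / 2) = 2^-1 :> R by lra.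
rewrite lnV ?posrE //; lra.
Qed.

(** Markov's inequality is applied once, to the sum of the two normalised squared errors, each of
    mean at most 1/N. Thus a single event of probability 2/3 controls both errors. *)
Lemma card_mean_concentration (R : realType) (W : finType) (N : nat) (a h : W -> R) (p q L : R) :
  (0 < N)%N -> 0 < L ->
  \sum_x a x = p * #|W|%:R -> \sum_x a x ^+ 2 <= #|W|%:R ->
  \sum_x h x = q * #|W|%:R -> \sum_x h x ^+ 2 <= L ^+ 2 * #|W|%:R ->
  2 / 3 * #|{: N.-tuple W}|%:R <=
  #|[pred w : N.-tuple W | ((\sum_(x <- w) a x) / N%:R - p) ^+ 2
      + (((\sum_(x <- w) h x) / N%:R - q) / L) ^+ 2 <= 6 / N%:R]|%:R :> R.
Proof.
move=> N0 L0 ha ha2 hh hh2; have N0' : 0 < N%:R :> R by rewrite ltr0n.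
have := @card_markov R _ (fun w : N.-tuple W => ((\sum_(x <- w) a x) / N%:R - p) ^+ 2
      + (((\sum_(x <- w) h x) / N%:R - q) / L) ^+ 2) (2 / N%:R).
have -> : 3 * (2 / N%:R) = 6 / N%:R :> R by rewrite mulrA -natrM.
apply.
- by rewrite divr_gt0.
- by move=> w; rewrite addr_ge0 // sqr_ge0.
rewrite big_split /=.
have -> : 2 / N%:R = 1 / N%:R + 1 / N%:R :> R by lra.
rewrite mulrDl; apply: lerD; first by apply: sum_mean_sqr => //; rewrite mul1r.
under eq_bigr do rewrite exprMn.
rewrite -mulr_suml exprVn ler_pdivrMr ?exprn_gt0 //.
apply: le_trans (sum_mean_sqr N0 hh hh2) _.
by rewrite le_eqVlt; apply/orP; left; apply/eqP; field; rewrite gt_eqF.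
Qed.

(** Since A >= p/2, the errors of ln A, of B/A through B, and of B/A through A are at most 2d/p,
    2Ld/p and 2Ld/p; their sum is at most 6Ld/p because L >= 1. *)
Lemma ln_sub_quotient_error (R : realType) (M p q A B L d e : R) :
  0 < M -> 0 < p -> 0 <= q <= L * p -> 1 <= L -> 0 <= d -> e <= 1 -> 6 * L * d <= e * p ->
  `|A - p| <= d -> `|B - q| <= L * d ->
  `|(ln (M * A) - B / A) - (ln (M * p) - q / p)| <= e.
Proof.
move=> M0 p0 /andP[q0 qL] L1 d0 e1 hd hA hB.
have hA' := hA; rewrite ler_distl in hA'; case/andP: hA' => A1 A2.
have dp : d <= p / 2 by nra.
have A0 : 0 < A by lra.
have Ap : p / 2 <= A by lra.
rewrite !lnM ?posrE //.
have -> : ln M + ln A - B / A - (ln M + ln p - q / p)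
  = (ln A - ln p) - ((B - q) / A + q / p * ((p - A) / A)).
  by field; rewrite !gt_eqF.
have invA : A^-1 <= 2 / p.
  by rewrite -[2 / p]invrK invf_div lef_pV2 ?posrE ?divr_gt0.
(* Used with the arguments in both orders to bound |ln A - ln p| from each side. *)
have lnb (x y : R) : 0 < x -> 0 < y -> ln x - ln y <= (x - y) / y.
  move=> x0 y0; rewrite -ln_div ?posrE //.
  have -> : x / y = 1 + (x - y) / y by field; rewrite gt_eqF.
  apply: le_ln1Dx; rewrite -subr_gt0 opprK.
  by rewrite (_ : _ + _ = x / y) ?divr_gt0 //; field; rewrite gt_eqF.
have hdp : 2 * (d / p) + 4 * (L * (d / p)) <= e.
  have : 6 * L * (d / p) <= e by rewrite mulrA ler_pdivrMr.
  have : 0 <= d / p by rewrite divr_ge0 // ltW.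
  nra.
have divA x k : `|x| <= k -> `|x / A| <= 2 * (k / p).
  move=> xk; rewrite normrM normfV (gtr0_norm A0) mulrCA.
  by apply: ler_pM => //; rewrite invr_ge0 ltW.
have dA : `|(p - A) / A| <= 2 * (d / p) by apply: divA; rewrite distrC.
have t1 : `|ln A - ln p| <= 2 * (d / p).
  rewrite ler_norml; apply/andP; split.
    rewrite lerNl opprB; apply: le_trans (lnb _ _ p0 A0) _.
    exact: le_trans (ler_norm _) dA.
  apply: le_trans (lnb _ _ A0 p0) _.
  by rewrite mulrA ler_pM2r ?invr_gt0 //; lra.
have t2 : `|(B - q) / A| <= 2 * (L * d / p) by exact: divA.
have t3 : `|q / p * ((p - A) / A)| <= L * (2 * (d / p)).
  rewrite normrM; apply: ler_pM => //.
  by rewrite ger0_norm ?ler_pdivrMr // divr_ge0 // ltW.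
apply: le_trans (ler_normB _ _) _; apply: le_trans hdp.
apply: lerD => //; apply: le_trans (ler_normD _ _) _.
by apply: le_trans (lerD t2 t3) _; rewrite le_eqVlt; apply/orP; left; apply/eqP; field; rewrite gt_eqF.
Qed.

(* If no sample is alive then [a = 0] and the value is [0], since [ln 0 = 0] and [b / 0 = 0]. *)
Definition entropy_est (R : realType) n (t : nat) (xs : seq (sample n)) : R :=
  let a := (\sum_(x <- xs) live (fun=> 1) x) / (size xs)%:R in
  let b := (\sum_(x <- xs) live (xlnx_diff R) x) / (size xs)%:R in
  if t == 0%N then 0 else (ln (t%:R * a) - b / a) / ln 2.

Lemma live_sqr (R : pzRingType) n (f : nat -> R) (x : sample n) :
  live f x ^+ 2 = live (fun r => f r ^+ 2) x.
Proof. by case: x => [[i r]|] //=; rewrite expr0n. Qed.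

(** With [p] the probability that a sample is alive and [q] the mean of its statistic, the entropy
    is (ln (M p) - q/p) / ln 2, where [M] is the number of insertions; the estimator substitutes
    empirical means for [p] and [q]. *)
Lemma entropy_est_correct (R : realType) n T N (s : seq (op n)) (eps beta : R) :
  let L : R := ln T%:R + 1 in
  (0 < T)%N -> (size s <= T)%N -> (0 < N)%N -> 0 < eps < 1 -> 0 < beta ->
  beta * (F1 (freq_noforget s))%:R <= (F1 (freq s))%:R ->
  6 / N%:R <= (eps * beta / (12 * L)) ^+ 2 ->
  2 / 3 * #|{: N.-tuple ((size s).-tuple 'I_T`!)}|%:R <=
  #|[pred W : N.-tuple ((size s).-tuple 'I_T`!) |
     `|entropy_est R (num_ins s) [seq reservoir 0 None s v | v : (size s).-tuple 'I_T`! <- W]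
        - entropy (freq s)| <= eps]|%:R :> R.
Proof.
move=> L T0 sT N0 /andP[eps0 eps1] beta0 hF1 hN; rewrite F1_noforget in hF1.
have L1 : 1 <= L by rewrite lerDr ln_ge0 // ler1n.
have diff_bounds r : (r < T)%N -> 0 <= xlnx_diff R r.+1 <= L by exact: xlnx_diff_bounds.
clearbody L.
have [M0|M0] := posnP (num_ins s).
  have m0 : F1 (freq s) = 0%N by apply/eqP; rewrite -leqn0 -M0 F1_freq_le.
  rewrite (_ : #|[pred W | _]| = #|{: N.-tuple ((size s).-tuple 'I_T`!)}|).
    by rewrite ler_piMl ?ler0n //; lra.
  apply: eq_card => W; rewrite !inE /entropy_est M0 eqxx entropyE m0 ln0 // invr0 mulr0.
  by rewrite !subr0 mul0r subr0 normr0 ltW.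
have M0' : 0 < (num_ins s)%:R :> R by rewrite ltr0n.
have [m mE] : {m : R | m = (F1 (freq s))%:R} by exists (F1 (freq s))%:R.
have mR : m = \sum_(i < n) (freq s i)%:R by rewrite mE /F1 natr_sum.
have freqT i : (freq s i <= T)%N by apply: leq_trans sT; exact: freq_le_size.
have mM : m <= (num_ins s)%:R by rewrite mE ler_nat F1_freq_le.
have bnd (f : nat -> R) K : (forall r, (r < T)%N -> f r.+1 <= K) ->
    \sum_(i < n) \sum_(r < freq s i) f r.+1 <= K * m.
  move=> fK; rewrite mR mulr_sumr; apply: ler_sum => i _.
  rewrite mulr_natr -[X in K *+ X]card_ord -sumr_const; apply: ler_sum => r _.
  by apply: fK; rewrite (leq_trans (ltn_ord r)).
have [p pE] : {p : R | p = m / (num_ins s)%:R} by exists (m / (num_ins s)%:R).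
have [q qE] : {q : R | q = (\sum_(i < n) xlnx R (freq s i)) / (num_ins s)%:R} by eexists.
have sums1 : \sum_(i < n) \sum_(r < freq s i) (1 : R) = m.
  by rewrite mR; apply: eq_bigr => i _; rewrite sumr_const card_ord.
have sumsx : \sum_(i < n) \sum_(r < freq s i) xlnx_diff R r.+1 = \sum_(i < n) xlnx R (freq s i).
  by apply: eq_bigr => i _; rewrite sum_xlnx_diff.
have beta_p : beta <= p by rewrite pE ler_pdivlMr // mE.
have p0 : 0 < p by apply: lt_le_trans beta_p.
have qL : 0 <= q <= L * p.
  apply/andP; split.
    rewrite qE divr_ge0 // -sumsx; apply: sumr_ge0 => i _; apply: sumr_ge0 => r _.
    by have /andP[] := diff_bounds _ (leq_trans (ltn_ord r) (freqT i)).
  rewrite qE pE mulrA ler_pM2r ?invr_gt0 // -sumsx; apply: bnd => r rT.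
  by have /andP[] := diff_bounds _ rT.
(* The second moments are at most p <= 1 for the indicator of being alive and L^2 p <= L^2 for the
   statistic. *)
have := @card_mean_concentration R ((size s).-tuple 'I_T`!) N (fun v => live (fun=> 1) (reservoir 0 None s v))
  (fun v => live (xlnx_diff R) (reservoir 0 None s v)) p q L N0 (lt_le_trans ltr01 L1).
under [in X in _ -> X -> _]eq_bigr do rewrite live_sqr.
under [in X in _ -> _ -> _ -> X -> _]eq_bigr do rewrite live_sqr.
rewrite !sum_live_reservoir // sums1 sumsx -pE -qE.
move=> /(_ erefl) conc.
apply: le_trans (conc _ erefl _) _.
- rewrite ler_piMl //; under eq_bigr do under eq_bigr do rewrite expr1n.
  by rewrite sums1 ler_pdivrMr // mul1r.
- rewrite ler_wpM2r // ler_pdivrMr //; apply: le_trans (bnd (fun r => xlnx_diff R r ^+ 2) (L ^+ 2) _) _ => [r rT|].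
    have /andP[h0 h1] := diff_bounds _ rT.
    by rewrite ler_pXn2r ?nnegrE //; lra.
  by rewrite ler_wpM2l ?sqr_ge0.
rewrite ler_nat; apply/subset_leq_card/fintype.subsetP => W; rewrite !inE => hW.
have {hW}hW := le_trans hW hN.
(* Chosen so that 6 L d = (eps/2) beta <= (eps/2) p. The error eps/2 in natural logarithms becomes
   at most eps in bits because ln 2 >= 1/2. *)
have [d dE] : {d : R | d = eps * beta / (12 * L)} by eexists.
rewrite -dE in hW.
have d0 : 0 <= d by rewrite dE divr_ge0 ?mulr_ge0 ?ltW //; lra.
rewrite /entropy_est size_map size_tuple gtn_eqF // !big_map entropyE -mE -mulrBl.
move: hW; set A := _ / N%:R; set B := _ / N%:R; move: A B => A B hW.
have hA : `|A - p| <= d.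
  rewrite -(ler_pXn2r (n := 2)) ?nnegrE // real_normK ?num_real //.
  by apply: le_trans hW; rewrite lerDl sqr_ge0.
have hB : `|B - q| <= L * d.
  have L0 : 0 < L by apply: lt_le_trans L1.
  rewrite mulrC -ler_pdivrMr // -[X in _ / X](gtr0_norm L0) -normfV -normrM.
  rewrite -(ler_pXn2r (n := 2)) ?nnegrE // real_normK ?num_real //.
  by apply: le_trans hW; rewrite lerDr sqr_ge0.
have := @ln_sub_quotient_error R (num_ins s)%:R p q A B L d (eps / 2) M0' p0 qL L1 d0.
have -> : (num_ins s)%:R * p = m by rewrite pE mulrCA divff ?mulr1 // gt_eqF.
have -> : q / p = (\sum_(i < n) xlnx R (freq s i)) / m.
  have m0 : m != 0 by apply: contraTneq p0 => e; rewrite pE e mul0r ltxx.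
  by rewrite qE pE; field; rewrite m0 gt_eqF.
move=> h; rewrite normrM normfV.
have ln2 := ln2_ge_half R.
rewrite [`|ln 2|]ger0_norm ?ler_pdivrMr; [|lra..].
apply: le_trans (h _ _ hA hB) _; [lra| |nra].
rewrite dE (_ : 6 * L * _ = eps * beta / 2); last by field; lra.
nra.
Qed.

(** * Space usage and the choice of parameters *)

(** As n >= 2, adding 1 to a power of n costs at most one more factor n: the counter has at most
    n^(c+1) values and each sample at most n^(c+3). *)
Lemma reservoir_card_le n c N : (1 < n)%N -> (0 < N)%N ->
  ((n ^ c).+1 * (n * (n ^ c).+1).+1 ^ N <= 2 ^ (up_log 2 n * (c.+1 + N * c.+3)))%N.
Proof.
move=> n1 N0; have n0 : (0 < n)%N by apply: ltnW.
have e0 k : (0 < n ^ k)%N by rewrite expn_gt0 n0.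
have h1 k : ((n ^ k).+1 <= n ^ k.+1)%N.
  rewrite expnS (leq_trans (n := 2 * n ^ k)) ?leq_mul2r ?n1 ?orbT //.
  by rewrite mul2n -addnn -addn1 leq_add2l.
have h2 : ((n * (n ^ c).+1).+1 <= n ^ c.+3)%N.
  by rewrite (leq_trans _ (h1 c.+2)) // ltnS [(n ^ c.+2)%N]expnS leq_mul2l h1 orbT.
rewrite expnM expnD (mulnC N).
have hn : (n <= 2 ^ up_log 2 n)%N by exact: up_logP.
apply: leq_mul; first by apply: leq_trans (h1 c) _; rewrite leq_exp2r.
by rewrite expnM leq_exp2r //; apply: leq_trans h2 _; rewrite leq_exp2r.
Qed.

Lemma up_log2_le (R : realType) n : (1 < n)%N -> (up_log 2 n)%:R <= 2 * log2 (n%:R : R).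
Proof.
move=> n1; have := up_log_gtn (isT : (1 < 2)%N) n1.
have ln2 := ln2_ge_half R.
have u0 : (0 < up_log 2 n)%N by rewrite up_log_gt0 n1.
rewrite -(ler_nat R) => hu.
have l1 : 1 <= log2 (n%:R : R).
  rewrite /log2 ler_pdivlMr ?mul1r; last lra.
  by rewrite ler_ln ?posrE ?ltr0n ?ler_nat // ltnW.
have : ((up_log 2 n).-1)%:R <= log2 (n%:R : R).
  rewrite /log2 ler_pdivlMr; last lra.
  rewrite mulr_natl -lnXn // ler_ln ?posrE ?ltr0n ?(ltnW n1) ?exprn_gt0 //.
  by rewrite -natrX; apply: le_trans hu; rewrite ler_nat.
rewrite -[in X in _ -> X](prednK u0) -natr1; lra.
Qed.

(* Applied with [l = log2 n], [ll = log2 (n / eps)], [b = 1 - alpha], [g = 1 - t n * alpha],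
   [L = ln (n ^ c) + 1], [u = up_log 2 n] and [N] the number of samples. *)
Lemma space_bound (R : realType) (c : nat) (l ll e b g L u N K : R) :
  0 <= K ->
  1 <= l -> l <= ll -> 0 < e < 1 -> 0 < b <= 1 -> 0 < g <= b -> b^-1 <= 2 * l ->
  1 <= L <= c.+1%:R * l -> 0 <= u <= 2 * l -> 1 <= N <= K * (L / (e * b)) ^+ 2 ->
  u * (c.+1%:R + N * c.+3%:R) <=
    4 * K * c.+1%:R ^+ 2 * (2 * c + 4)%N%:R / (e ^+ 2 * g) * ll ^+ 4.
Proof.
move=> K0 l1 lll /andP[e0 e1] /andP[b0 b1] /andP[g0 gb] bl /andP[L1 Lc] /andP[u0 ul] /andP[N1 hN].
have l0 : 0 <= l by lra.
have L0 : 0 <= L by lra.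
have ei0 : 0 <= (e ^+ 2)^-1 by rewrite invr_ge0 exprn_ge0 // ltW.
have gi0 : 0 <= g^-1 by rewrite invr_ge0 ltW.
have bi0 : 0 <= b^-1 by rewrite invr_ge0 ltW.
have bg : b^-1 <= g^-1 by rewrite lef_pV2 ?posrE.
(* Of the two factors 1/b, one is bounded by 2l and the other by 1/g, so that g enters only to the
   first power. *)
have hLX : (L / (e * b)) ^+ 2 <= (c.+1%:R * l) ^+ 2 * (e ^+ 2)^-1 * (2 * l * g^-1).
  rewrite (_ : (L / (e * b)) ^+ 2 = L ^+ 2 * (e ^+ 2)^-1 * (b^-1 * b^-1)); last first.
    by field; rewrite !gt_eqF.
  apply: ler_pM; rewrite ?mulr_ge0 ?exprn_ge0 //; last by apply: ler_pM.
  by apply: ler_wpM2r => //; rewrite ler_pXn2r ?nnegrE ?mulr_ge0.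
have h1 : c.+1%:R + N * c.+3%:R <= N * (2 * c + 4)%N%:R.
  have -> : (2 * c + 4 = c.+1 + c.+3)%N by rewrite mul2n -addnn addSn !addnS addn0.
  by rewrite natrD [leRHS]mulrDr; apply: lerD => //; rewrite ler_peMl.
apply: (@le_trans _ _ (2 * l * (K * ((c.+1%:R * l) ^+ 2 * (e ^+ 2)^-1 * (2 * l * g^-1))
    * (2 * c + 4)%N%:R))).
  apply: ler_pM => //; first by rewrite addr_ge0 // mulr_ge0 //; lra.
  apply: le_trans h1 _; apply: ler_wpM2r => //.
  exact: le_trans hN (ler_wpM2l K0 hLX).
(* The four powers of l come from u, from L twice, and from the factor 1/b traded for 2l. *)
rewrite (_ : 2 * l * _ = 4 * K * c.+1%:R ^+ 2 * (2 * c + 4)%N%:R / (e ^+ 2 * g) * l ^+ 4); last first.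
  by field; rewrite !gt_eqF.
apply: ler_wpM2l; last by rewrite ler_pXn2r ?nnegrE //; lra.
by rewrite mulr_ge0 ?invr_ge0 ?mulr_ge0 ?exprn_ge0 // ltW.
Qed.

Theorem mainTheorem18 (R : realType) (c : nat) :
  exists (C : R) (k : nat) (N0 : nat) (c0 : R) (t : nat -> R),
    0 < C /\
    (forall n : nat, (N0 <= n)%N -> `|t n - 1| <= c0 / ln (n%:R : R)) /\
    forall (n : nat) (eps alpha : R),
      (N0 <= n)%N -> 0 < eps < 1 -> 0 < alpha < 1 ->
      0 < 1 - t n * alpha ->
      exists A : streaming_alg R n,
        (forall s : seq (op n), (size s <= n ^ c)%N ->
           space_le A (C / (eps ^+ 2 * (1 - t n * alpha))
                         * (log2 (n%:R / eps)) ^+ k) s) /\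
        (forall s : seq (op n), (size s <= n ^ c)%N ->
           `|entropy (freq s) - entropy (freq_noforget s)|
              <= alpha * entropy (freq_noforget s) ->
           (F1 (freq s))%:R >= (1 - alpha) * (F1 (freq_noforget s))%:R ->
           success_prob A s (fun x => `|x - entropy (freq s)| <= eps)
             >= 2 / 3).
Proof.
(* 864 = 6 * 12 ^ 2, from the hypothesis of [entropy_est_correct]; [K] is kept abstract because
   unification would unfold the unary literal. *)
have [K KE] : {K : R | K = 864} by eexists.
have K0 : 0 < K by lra.
(* The constant of [space_bound] at [K + 1]: the extra 1 pays for rounding the number of samples up.
   From n = 2 on, ln n is positive. *)
exists (4 * (K + 1) * c.+1%:R ^+ 2 * (2 * c + 4)%N%:R), 4%N, 2%N, 1, (fun n => 1 + (ln n%:R)^-1).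
have ln2 := ln2_ge_half R.
have ln2le : ln 2 <= 1 :> R by have := @le_ln1Dx R 1; lra.
have lnn n : (2 <= n)%N -> 0 < ln n%:R :> R by move=> n2; rewrite ln_gt0 // ltr1n.
split.
  by rewrite !mulr_gt0 ?addr_gt0 ?exprn_gt0 ?ltr0n ?addn_gt0 ?orbT.
split=> [n n2|n eps alpha n2 /[dup] epsI /andP[eps0 eps1] /andP[alpha0 alpha1] ta].
  by rewrite addrAC subrr add0r mul1r ger0_norm // invr_ge0 ltW // lnn.
have n0 : (0 < n)%N by apply: ltnW.
have lnn0 := lnn n n2.
have [g gE] : {g : R | g = 1 - (1 + (ln n%:R)^-1) * alpha} by eexists.
have [b bE] : {b : R | b = 1 - alpha} by eexists.
have [L LE] : {L : R | L = ln (n ^ c)%N%:R + 1} by eexists.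
have [l lE] : {l : R | l = log2 n%:R} by eexists.
have [ll llE] : {ll : R | ll = log2 (n%:R / eps)} by eexists.
rewrite -gE in ta *; rewrite -llE.
have nl : ln n%:R <= l.
  by rewrite lE /log2 ler_pdivlMr; [rewrite ler_piMr // ltW|lra].
have l1 : 1 <= l.
  rewrite lE /log2 ler_pdivlMr ?mul1r; last lra.
  by rewrite ler_ln ?posrE ?ltr0n ?ler_nat.
have lll : l <= ll.
  rewrite lE llE /log2 ler_pM2r ?invr_gt0; last lra.
  rewrite ler_ln ?posrE ?divr_gt0 ?ltr0n // ler_peMr // invf_ge1 // ltW //.
have b0 : 0 < b by rewrite bE; lra.
have gb : g <= b.
  have : 0 <= (ln n%:R)^-1 * alpha by rewrite mulr_ge0 ?invr_ge0 ?ltW.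
  by rewrite gE bE; lra.
(* [t n = 1 + 1 / ln n] is chosen so that [0 < 1 - t n * alpha] forces [1 - alpha >= 1 / (ln n + 1)]:
   one of the two factors [1 / (1 - alpha)] in the number of samples is then polylogarithmic. *)
have bl : b^-1 <= 2 * l.
  have : alpha * (ln n%:R + 1) <= ln n%:R.
    have := ta; rewrite gE -(pmulr_rgt0 _ lnn0) => h; apply: ltW; rewrite -subr_gt0.
    apply: lt_le_trans h _; rewrite le_eqVlt; apply/orP; left; apply/eqP.
    by field; rewrite gt_eqF.
  move=> h; rewrite -[_^-1]mul1r ler_pdivrMr // bE; nra.
have L1 : 1 <= L <= c.+1%:R * l.
  rewrite LE natrX lnXn ?ltr0n // -[ln _ *+ c]mulr_natl lerDr mulr_ge0 ?ler0n ?(ltW lnn0) //=.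
  by rewrite -[c.+1%:R]natr1 mulrDl mul1r lerD // ler_wpM2l.
pose X := K * (L / (eps * b)) ^+ 2.
have X0 : 0 <= X by rewrite mulr_ge0 ?sqr_ge0 ?(ltW K0).
have /andP[NX XN] := truncn_itv X0.
set N := (Num.truncn X).+1 in XN.
have b1 : b <= 1 by rewrite bE; lra.
(* This lets the additive 1 of the rounding be absorbed into the multiplicative constant. *)
have hY : 1 <= (L / (eps * b)) ^+ 2.
  case/andP: L1 => L1 _; rewrite exprn_ege1 // ler_pdivlMr ?mulr_gt0 // mul1r.
  by rewrite (le_trans _ L1) // mulr_ile1 // ltW.
have hN : 1 <= (N%:R : R) <= (K + 1) * (L / (eps * b)) ^+ 2.
  rewrite ler1n /= /N -[_.+1%:R]natr1.
  by rewrite mulrDl mul1r lerD.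
have [A [spA prA]] := @reservoir_alg n (n ^ c) (n ^ c)`! N R (entropy_est R (n := n)) _
  (fact_gt0 _) (reservoir_card_le c n2 (ltn0Sn _)).
exists A; split=> s hs.
  move=> w st /(spA s w) h; apply: le_trans h _.
  rewrite natrM natrD natrM; apply: (space_bound (l := l) (b := b) (L := L)) => //.
  - by rewrite addr_ge0 // ltW.
  - by rewrite b0.
  - by rewrite ta.
  - by rewrite ler0n lE up_log2_le.
move=> _ hF; rewrite prA // ler_pdivlMr; last first.
  rewrite ltr0n card_tuple expn_gt0 card_tuple card_ord expn_gt0 fact_gt0 //.
apply: entropy_est_correct b0 _ _ => //.
- by rewrite expn_gt0 n0.
- by rewrite bE.
rewrite -LE; have N0 : 0 < N%:R :> R by rewrite ltr0n.
case/andP: L1 => L1 _.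
rewrite ler_pdivrMr //.
have Y0 : 0 < (eps * b / (12 * L)) ^+ 2.
  by rewrite exprn_gt0 // divr_gt0 // mulr_gt0 //; lra.
rewrite mulrC -ler_pdivrMr //; apply: le_trans (ltW XN).
rewrite /X KE le_eqVlt; apply/orP; left; apply/eqP; field.
by rewrite !gt_eqF //; lra.
Qed.
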